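(* Let $A \in \mathcal M_d(\mathbb R)$ satisfy $\rho(A) < 1$, and let $\tau$ be a bounded delay function such that $\inf_{s \in [0, t]} \tau(s) > 0$ for every $t \geq 0$ and such that, with $\sigma_1(t) = t - \tau(t)$ for $t \in \mathbb R_+$, $\mathcal L(\sigma_1^{-1}(N)) = 0$ for every Lebesgue-measurable $N \subset \mathbb R$ with $\mathcal L(N) = 0$. Let $h$ be the largest delay function associated with $\tau$. Then there exist positive constants $C$ and $\gamma$ such that, for every $L^\infty$ solution $x \in L^\infty_{\mathrm{loc}}(\lvert -h(0), +\infty), \mathbb R^d)$ of $$x(t) = A x(t - \tau(t)), \qquad t \geq 0,$$ with an initial condition $x_0 \in L^\infty(\lvert -h(0), 0), \mathbb R^d)$, we have $$\lVert x_t\rVert_{L^\infty(\lvert -h(t), 0), \mathbb R^d)} \leq C e^{-\gamma t} \lVert x_0\rVert_{L^\infty(\lvert -h(0), 0), \mathbb R^d)} \qquad \text{for every } t \in \mathbb R_+.$$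
   Context: $\mathbb R_+ = [0, +\infty)$, $\mathbb R_+^\ast = (0, +\infty)$; $\mathcal M_d(\mathbb R)$ is the set of real $d \times d$ matrices, $d$ a positive integer, and $\rho(A)$ is the spectral radius of $A$; $\mathcal L$ is Lebesgue measure. For $a \leq b$ in $\mathbb R \cup \{\pm\infty\}$, the interval $\lvert a, b)$ denotes $[a, b)$ if $a > -\infty$ and $(a, b)$ if $a = -\infty$. A \emph{delay function} is any function $\tau\colon \mathbb R_+ \to \mathbb R_+^\ast$. Its \emph{largest delay function} is $h\colon \mathbb R_+ \to \mathbb R_+^\ast \cup \{+\infty\}$, $h(t) = t - \inf_{s \in [t, +\infty)} (s - \tau(s))$. An \emph{a.e. solution} is a function $x\colon \lvert -h(0), +\infty) \to \mathbb R^d$ such that, for every $\widetilde x\colon \lvert -h(0), +\infty) \to \mathbb R^d$ equal to $x$ a.e., we have $\widetilde x(t) = A \widetilde x(t - \tau(t))$ for a.e. $t \in \mathbb R_+$. An \emph{$L^\infty$ solution} is a Lebesgue-measurable a.e. solution $x$ with $x \in L^\infty_{\mathrm{loc}}(\lvert -h(0), +\infty), \mathbb R^d)$. Its \emph{initial condition} is its restriction to $\lvert -h(0), 0)$. For $t \in \mathbb R_+$, $x_t\colon \lvert -h(t), 0) \to \mathbb R^d$ is defined by $x_t(s) = x(t + s)$. *)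

(* Defs.v *)
From HB Require Import structures.
From mathcomp Require Import all_boot all_order all_algebra.
From mathcomp Require Import all_classical all_reals all_analysis.
From mathcomp Require Import complex.

Set Implicit Arguments.
Unset Strict Implicit.
Unset Printing Implicit Defensive.

Import Order.TTheory GRing.Theory Num.Theory.
Import numFieldNormedType.Exports.

Local Open Scope classical_set_scope.
Local Open Scope ring_scope.

(* Maximal modulus of the complex eigenvalues of a real matrix. *)
Definition spectral_radius (R : realType) (d : nat) (A : 'M[R]_d) : R :=
  sup [set ComplexField.Normc.normc z |
       z in [set z : R[i] | eigenvalue (map_mx (real_complex R) A) z]].

(* R with the sigma-algebra of Lebesgue (not only Borel) measurable sets. *)
Notation lebesgueType R := (caratheodory_type (((@wlength R idfun)^*)%mu)).

(* |a, b): closed on the left when a is finite, open when a = -oo. *)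
Definition lcitv (R : realType) (a b : \bar R) : set R :=
  [set s : R | (a <= s%:E < b)%E].

(* Functions on a subset D of R are represented by total functions on R, whose
   values outside D play no role; likewise delay functions outside R_+. *)

Definition Linfty_norm (R : realType) (d : nat) (D : set R)
    (f : R -> 'cV[R]_d) : \bar R :=
  Lnorm (@completed_lebesgue_measure R) +oo%E
    ((fun s => (`|f s|)%:E) \_ D).

Definition Lebesgue_measurable_fun (R : realType) (d : nat) (D : set R)
    (f : R -> 'cV[R]_d) : Prop :=
  @measurable_fun _ _ (lebesgueType R) (g_sigma_algebraType (@open 'cV[R]_d))
    D f.

Definition Linfty (R : realType) (d : nat) (D : set R)
    (f : R -> 'cV[R]_d) : Prop :=
  Lebesgue_measurable_fun D f /\ (Linfty_norm D f < +oo)%E.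

Definition Linfty_loc (R : realType) (d : nat) (D : set R)
    (f : R -> 'cV[R]_d) : Prop :=
  Lebesgue_measurable_fun D f /\
  forall K : set R, compact K -> K `<=` D -> (Linfty_norm K f < +oo)%E.

Definition delay_function (R : realType) (tau : R -> R) : Prop :=
  forall t, 0 <= t -> 0 < tau t.

Definition largest_delay (R : realType) (tau : R -> R) (t : R) : \bar R :=
  (t%:E - ereal_inf [set (s - tau s)%:E | s in `[t, +oo[%classic])%E.

(* completed_lebesgue_measure is an outer measure defined on all sets, and is
   complete: vanishing on a set entails that this set is Lebesgue measurable. *)
Definition preserves_null_sets (R : realType) (tau : R -> R) : Prop :=
  forall N : set (lebesgueType R), measurable N ->
    completed_lebesgue_measure N = 0%E ->
    completed_lebesgue_measure
      ([set t : R | 0 <= t /\ N (t - tau t)] : set (lebesgueType R)) = 0%E.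

Definition ae_solution (R : realType) (d : nat) (A : 'M[R]_d) (tau : R -> R)
    (x : R -> 'cV[R]_d) : Prop :=
  forall y : R -> 'cV[R]_d,
    (\forall s \ae @completed_lebesgue_measure R,
       lcitv (- largest_delay tau 0) +oo s -> y s = x s) ->
    \forall t \ae @completed_lebesgue_measure R,
       0 <= t :> R -> y t = A *m y (t - tau t).

Definition Linfty_solution (R : realType) (d : nat) (A : 'M[R]_d)
    (tau : R -> R) (x : R -> 'cV[R]_d) : Prop :=
  ae_solution A tau x /\ Linfty_loc (lcitv (- largest_delay tau 0) +oo) x.

Definition history (R : realType) (d : nat) (x : R -> 'cV[R]_d) (t : R) :
    R -> 'cV[R]_d :=
  fun s => x (t + s).

(* Main.v *)
Require Import Defs.
From HB Require Import structures.
From mathcomp Require Import all_boot all_order all_algebra.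
From mathcomp Require Import all_classical all_reals all_analysis.
From mathcomp Require Import ess_sup_inf complex ring lra.

(** The equation transports [x] along the orbit [t], [t - tau t], ... until the
    orbit leaves [R_+], so [x t = A ^+ n *m x u] with [u] in the initial
    interval. The lower bound on [tau] makes [n] finite and the upper bound [M]
    forces [n >= t / M]; since [A ^+ n] is bounded by [K * r ^+ n] for any
    [r > spectral_radius A], this gives the exponential decay. Pointwise
    reasoning is legitimate for almost every [t] because the countably many
    iterated preimages of the exceptional null sets are null. *)

Set Implicit Arguments.
Unset Strict Implicit.
Unset Printing Implicit Defensive.

Import Order.TTheory GRing.Theory Num.Theory.
Import numFieldNormedType.Exports.

Local Open Scope classical_set_scope.
Local Open Scope ring_scope.

(** * Eigenvalues and the growth of matrix powers *)

Lemma normc_ge0 (R : realType) (z : R[i]) : 0 <= ComplexField.Normc.normc z.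
Proof. by case: z => a b; rewrite /= sqrtr_ge0. Qed.

Lemma normc_real (R : realType) (a : R) :
  ComplexField.Normc.normc (real_complex R a) = `|a|.
Proof. by rewrite /= expr0n addr0 sqrtr_sqr. Qed.

(** A [sup] dominates its members only if the set is bounded: the eigenvalues are the roots of the
    characteristic polynomial, and the sum of the moduli of these roots is an upper bound. *)
Lemma eigenvalue_le_spectral_radius (R : realType) (d : nat) (A : 'M[R]_d)
    (z : R[i]) :
  eigenvalue (map_mx (real_complex R) A) z ->
  ComplexField.Normc.normc z <= spectral_radius A.
Proof.
move=> Az; apply: ub_le_sup; last by exists z.
have [s Ds] := closed_field_poly_normal (char_poly (map_mx (real_complex R) A)).
exists (\sum_(y <- s) ComplexField.Normc.normc y) => _ [y By <-].
move: By; rewrite /mkset eigenvalue_root_char Ds (monicP (char_poly_monic _)).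
rewrite scale1r root_prod_XsubC => ys.
by rewrite (big_rem y ys) lerDl sumr_ge0// => ? _; exact: normc_ge0.
Qed.

(* Peeling off one factor [A - z] turns the bound for [W = (A - z) V] into the
   recursion [A^(n+1) V = z A^n V + A^n W], whose solution again grows at most
   like [r^n] because [|z| < r]. *)
Lemma power_bound_of_annihilator (R : realType) (d : nat)
    (A V : 'M[R[i]]_d.+1) (s : seq R[i]) (q r : R) :
  0 <= q -> q < r ->
  (forall z, z \in s -> ComplexField.Normc.normc z <= q) ->
  (\prod_(z <- s) (A - z%:M)) * V = 0 ->
  exists2 K : R, 0 <= K &
    forall n i j, ComplexField.Normc.normc ((A ^+ n * V) i j) <= K * r ^+ n.
Proof.
move=> q0 qr; have r0 : 0 < r by apply: le_lt_trans qr.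
elim/last_ind: s V => [|s z IHs] V sq.
  rewrite big_nil mul1r => ->; exists 0 => // n i j.
  by rewrite mulr0 mul0r mxE ComplexField.Normc.normc0.
rewrite -cats1 big_cat big_seq1 /= -mulrA => /IHs[|K K0 KW].
  by move=> y ys; apply: sq; rewrite mem_rcons inE ys orbT.
have zq : ComplexField.Normc.normc z <= q.
  by apply: sq; rewrite mem_rcons mem_head.
pose K0' := \sum_i \sum_j ComplexField.Normc.normc (V i j).
have K0'0 : 0 <= K0'.
  by apply: sumr_ge0 => i _; apply: sumr_ge0 => j _; exact: normc_ge0.
have rq0 : 0 < r - q by rewrite subr_gt0.
have Kq0 : 0 <= K / (r - q) by rewrite divr_ge0// ltW.
(* [K0'] covers [n = 0], and [c = K / (r - q)] solves [q * c + K = r * c], which closes the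
   recursion. *)
exists (K0' + K / (r - q)); first by rewrite addr_ge0.
elim=> [|n IHn] i j.
  rewrite expr0 mul1r mulr1 (le_trans (y := K0'))// ?lerDl//.
  rewrite /K0' (bigD1 i)//= (bigD1 j)//= -addrA lerDl addr_ge0//.
    by rewrite sumr_ge0// => k _; exact: normc_ge0.
  by apply: sumr_ge0 => k _; apply: sumr_ge0 => l _; exact: normc_ge0.
have -> : A ^+ n.+1 * V = z *: (A ^+ n * V) + A ^+ n * ((A - z%:M) * V).
  rewrite mulrBl mulrBr mulrA -exprSr -[z%:M * V]/(z%:M *m V) mul_scalar_mx.
  by rewrite -scalerAr addrC subrK.
rewrite mxE [X in X + _]mxE; apply: le_trans (le_normcD _ _) _.
rewrite ComplexField.Normc.normcM.
have h1 := KW n i j; have h2 := IHn i j.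
apply: (@le_trans _ _ (q * ((K0' + K / (r - q)) * r ^+ n) + K * r ^+ n)).
  apply: lerD => //; apply: ler_pM => //; exact: normc_ge0.
rewrite exprS [q * _]mulrA -mulrDl [leRHS]mulrA ler_pM2r ?exprn_gt0//.
have : (K / (r - q)) * (r - q) = K by rewrite divfK// gt_eqF.
by nra.
Qed.

(** By Cayley-Hamilton over [R[i]], the product of the [A - z] over the roots [z] of the
    characteristic polynomial vanishes, so the annihilator bound applies with [V = 1]. *)
Lemma power_bound_of_spectral_radius (R : realType) (d : nat)
    (A : 'M[R]_d.+1) (r : R) : spectral_radius A < r -> 0 < r ->
  exists2 K : R, 0 <= K & forall n i j, `|(A ^+ n) i j| <= K * r ^+ n.
Proof.
move=> Ar r0.
set B := map_mx (real_complex R) A.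
have [s Ds] := closed_field_poly_normal (char_poly B).
move: Ds; rewrite (monicP (char_poly_monic _)) scale1r => Ds.
have := Cayley_Hamilton B; rewrite Ds rmorph_prod.
under eq_bigr do rewrite rmorphB/= horner_mx_X horner_mx_C.
move=> s0.
have [||z zs||K K0 KB] := @power_bound_of_annihilator R d B 1 s
    (Num.max (spectral_radius A) 0) r.
- by rewrite le_max lexx orbT.
- by rewrite gt_max Ar.
- rewrite le_max eigenvalue_le_spectral_radius//.
  by rewrite eigenvalue_root_char Ds root_prod_XsubC.
- by rewrite mulr1.
exists K => // n i j; have := KB n i j.
by rewrite mulr1 -(rmorphXn (map_mx (real_complex R))) mxE normc_real.
Qed.

Lemma norm_power_bound (R : realType) (d : nat) (A : 'M[R]_d.+1) (r : R) :
  spectral_radius A < r -> 0 < r ->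
  exists2 K : R, 0 <= K &
    forall n (v : 'cV[R]_d.+1), `|A ^+ n *m v| <= K * r ^+ n * `|v|.
Proof.
move=> Ar r0; have [K K0 KA] := power_bound_of_spectral_radius Ar r0.
(* The norm is the largest entry, and each entry of the product is a sum of [d.+1] terms. *)
exists (K *+ d.+1); first by rewrite mulrn_wge0.
move=> n v; have Kr0 : 0 <= K * r ^+ n by rewrite mulr_ge0// exprn_ge0// ltW.
rewrite [X in X <= _]/Num.Def.normr/= mx_normrE.
apply: bigmax_le => [|[i j] _ /=].
  by rewrite mulr_ge0// mulrnAl mulrn_wge0.
rewrite mxE (le_trans (ler_norm_sum _ _ _))//.
rewrite !mulrnAl; set a := K * _ * _.
have <- : \sum_(k < d.+1) a = a *+ d.+1 by rewrite sumr_const card_ord.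
apply: ler_sum => k _; rewrite normrM ler_pM// /Num.Def.normr/= mx_normrE.
exact: (le_bigmax _ (fun ij => `|v ij.1 ij.2|) (k, j)).
Qed.

(** * Null sets under translation and under the delay *)

Lemma completed_negligibleP (R : realType) (N : set (lebesgueType R)) :
  (@completed_lebesgue_measure R).-negligible N <->
  completed_lebesgue_measure N = 0%E.
Proof.
split=> [[/= A [mA A0 NA]]|N0].
  apply/eqP; rewrite eq_le; apply/andP; split; last exact: outer_measure_ge0.
  by rewrite -[X in (_ <= X)%E]A0; exact: le_outer_measure.
have /negligible_outer_measure[A [mA A0 NA]] :
    ((@wlength R idfun)^* N)%mu = 0%E.
  exact: N0.
by exists A; split => //; exact: sub_caratheodory.
Qed.

Lemma wlength_shift (R : realType) (t : R) (X : set R) : ocitv X ->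
  ocitv [set s | X (t + s)] /\
  wlength idfun [set s | X (t + s)] = wlength idfun X.
Proof.
move=> /ocitvP[->|[[a b] /= ab ->]].
  have -> : [set s | set0 (t + s)] = set0 :> set R by [].
  by split => //; exact: ocitv0.
have -> : [set s | `]a, b]%classic (t + s)] = `](a - t), (b - t)]%classic.
  by apply/seteqP; split => s /=; rewrite !in_itv/= => /andP[? ?]; lra.
split; first exact: is_ocitv.
rewrite !wlength_itv/= !lte_fin ltrD2r ab; congr EFin => /=; ring.
Qed.

(** Translating a cover by half-open intervals preserves its total length, and the outer measure is
    an infimum over such covers. *)
Lemma completed_lebesgue_measure_shift_le (R : realType) (t : R) (N : set R) :
  (completed_lebesgue_measure ([set s | N (t + s)%R] : set (lebesgueType R)) <=
   completed_lebesgue_measure (N : set (lebesgueType R)))%E.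
Proof.
apply: ereal_inf_le_tmp => _ [F [mF NF] <-].
exists (fun n => [set s | F n (t + s)]).
  split=> [n|s /NF[n _ Fn]]; first by have [] := wlength_shift t (mF n).
  by exists n.
by apply: eq_eseriesr => n _; have [] := wlength_shift t (mF n).
Qed.

Lemma ae_shift (R : realType) (t : R) (P : R -> Prop) :
  (\forall s \ae @completed_lebesgue_measure R, P s) ->
  \forall s \ae @completed_lebesgue_measure R, P (t + s).
Proof.
move=> /completed_negligibleP P0; apply/completed_negligibleP.
apply/eqP; rewrite eq_le; apply/andP; split; last exact: outer_measure_ge0.
rewrite -[X in (_ <= X)%E]P0.
exact: (@completed_lebesgue_measure_shift_le _ t (~` [set s | P s])).
Qed.

Lemma ae_delayed (R : realType) (tau : R -> R) (P : R -> Prop) :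
  preserves_null_sets tau ->
  (\forall s \ae @completed_lebesgue_measure R, P s) ->
  \forall t \ae @completed_lebesgue_measure R, 0 <= t :> R -> P (t - tau t).
Proof.
move=> tau_null [N [mN N0 PN]]; apply/completed_negligibleP.
apply/eqP; rewrite eq_le; apply/andP; split; last exact: outer_measure_ge0.
rewrite -[X in (_ <= X)%E](tau_null N mN N0); apply: le_outer_measure => t /=.
by move=> /not_implyP[t0 nP]; split => //; exact: PN.
Qed.

(** * Transport along the orbits of the delay *)

(** The guard tests the current point and not the next one, so [P] is also required at the first
    negative point of the orbit, where the initial data are read. *)
Fixpoint holds_along (R : realType) (tau : R -> R) (P : R -> Prop) (n : nat)
    (t : R) : Prop :=
  P t /\ if n is m.+1 then 0 <= t -> holds_along tau P m (t - tau t) else True.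

Lemma ae_holds_along (R : realType) (tau : R -> R) (P : R -> Prop) :
  preserves_null_sets tau ->
  (\forall s \ae @completed_lebesgue_measure R, P s) ->
  \forall t \ae @completed_lebesgue_measure R, forall n, holds_along tau P n t.
Proof.
move=> tau_null aeP.
have aeF := ae_filter_ringOfSetsType (@completed_lebesgue_measure R).
apply: ae_foralln; elim=> [|n /(ae_delayed tau_null) aen].
  by apply: filterS aeP => s.
by apply: filterS2 aeP aen => s.
Qed.

(** Induction on [k]: a step back of at least [e] uses up one [e] of [e *+ k], and being at most [M]
    it costs one [M] of [M *+ n]. The orbit moves left, so it stays below [T], where [e] bounds
    [tau]. *)
Lemma iterated_delay_equation (R : realType) (d : nat) (A : 'M[R]_d.+1)
    (tau : R -> R) (x : R -> 'cV[R]_d.+1) (M e T : R) (P : R -> Prop)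
    (Q : 'cV[R]_d.+1 -> Prop) (t : R) (k : nat) :
  0 < M -> (forall s, 0 <= s -> tau s <= M) ->
  0 <= e -> (forall s, 0 <= s <= T -> e <= tau s) ->
  (forall s, P s -> 0 <= s -> x s = A *m x (s - tau s)) ->
  (forall s, 0 <= s -> P (s - tau s) -> s - tau s < 0 -> Q (x (s - tau s))) ->
  0 <= t <= T -> t < e *+ k -> holds_along tau P k t ->
  exists n v, [/\ t <= M *+ n, Q v & x t = A ^+ n *m v].
Proof.
move=> M0 tauM e0 taue eq_x init_x; elim: k t => [|k IHk] t /andP[t0 tT].
  by rewrite mulr0n => ?; lra.
rewrite mulrSr => tk [Pt /(_ t0) along].
have tM := tauM t t0.
have te : e <= tau t by apply: taue; rewrite t0.
have [s0|s0] := leP 0 (t - tau t).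
  have [|||n [v [tn Qv xv]]] := IHk (t - tau t) => //.
  - by rewrite s0/=; lra.
  - by lra.
  exists n.+1, v; split => //; first by rewrite mulrSr; lra.
  by rewrite (eq_x t)// xv mulmxA exprS.
exists 1%N, (x (t - tau t)); split; first by rewrite mulr1n; lra.
- by apply: init_x => //; case: k {IHk tk} along => [|k] [].
- by rewrite expr1 eq_x.
Qed.

(** * History intervals and essential bounds *)

Lemma lcitv_largest_delayP (R : realType) (tau : R -> R) (t s : R) :
  lcitv (- largest_delay tau t) 0 s <->
  (ereal_inf [set (u - tau u)%:E | u in `[t, +oo[%classic] <= (t + s)%:E)%E
    /\ s < 0.
Proof.
rewrite /lcitv /largest_delay /mkset; case: ereal_inf => [i||] /=.
- rewrite !lte_fin !lee_fin. split.
    by move=> /andP[? ?]; split => //; lra.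
  by move=> [? ->]; rewrite andbT; lra.
- by split => [|[]].
- by rewrite lte_fin !leNye; split=> [/andP[]|[]].
Qed.

Lemma Linfty_norm_fin_num (R : realType) (d : nat) (D : set R)
    (f : R -> 'cV[R]_d) : (Linfty_norm D f < +oo)%E ->
  Linfty_norm D f \is a fin_num.
Proof. by move=> fD; rewrite ge0_fin_numE// Lnorm_ge0. Qed.

(** [Lnorm] at [+oo] is the essential supremum only if the whole space has positive measure, and 0
    otherwise; hence the assumption. *)
Lemma ae_le_Linfty_norm (R : realType) (d : nat) (D : set R)
    (f : R -> 'cV[R]_d) :
  (0 < @completed_lebesgue_measure R setT)%E ->
  \forall s \ae @completed_lebesgue_measure R,
    D s -> ((`|f s|)%:E <= Linfty_norm D f)%E.
Proof.
move=> muT; rewrite /Linfty_norm unlock muT.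
have aeF := ae_filter_ringOfSetsType (@completed_lebesgue_measure R).
set g := _ \_ D.
apply: filterS (ess_sup_ge (@completed_lebesgue_measure R) (abse \o g)) => s.
by move=> gs Ds; move: gs; rewrite /= /g patchE mem_set//= normr_id.
Qed.

Lemma Linfty_norm_le (R : realType) (d : nat) (D : set R)
    (f : R -> 'cV[R]_d) (b : \bar R) : (0 <= b)%E ->
  ((0 < @completed_lebesgue_measure R setT)%E ->
   \forall s \ae @completed_lebesgue_measure R,
     D s -> ((`|f s|)%:E <= b)%E) ->
  (Linfty_norm D f <= b)%E.
Proof.
move=> b0 fb; rewrite /Linfty_norm unlock; case: ifPn => // muT.
have aeF := ae_filter_ringOfSetsType (@completed_lebesgue_measure R).
apply/ess_supP; apply: filterS (fb muT) => s /= Db.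
rewrite patchE; case: ifPn => [/set_mem/Db|_]; first by rewrite /= normr_id.
by rewrite abse0.
Qed.

Theorem corollary5p19 (R : realType) (d : nat) (d_gt0 : (0 < d)%N)
    (A : 'M[R]_d) (rhoA : spectral_radius A < 1)
    (tau : R -> R) (tau_delay : delay_function tau)
    (tau_bounded : [bounded tau t | t in `[0, +oo[%classic])
    (tau_inf : forall t : R, 0 <= t ->
       0 < inf [set tau s | s in `[0, t]%classic])
    (tau_null : preserves_null_sets tau) :
  exists C gamma : R, [/\ 0 < C, 0 < gamma &
    forall x : R -> 'cV[R]_d,
      Linfty_solution A tau x ->
      Linfty (lcitv (- largest_delay tau 0) 0) (history x 0) ->
      forall t : R, 0 <= t ->
        (Linfty_norm (lcitv (- largest_delay tau t) 0) (history x t)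
         <= (C * expR (- gamma * t))%:E *
            Linfty_norm (lcitv (- largest_delay tau 0) 0) (history x 0))%E].
Proof.
case: d d_gt0 A rhoA => [//|d] _ A rhoA.
have [M M0 tauM] : exists2 M : R, 0 < M & forall s, 0 <= s -> tau s <= M.
  have [M M0 tauM] := pinfty_ex_gt0 tau_bounded.
  exists M => // s s0; apply: le_trans (ler_norm _) (tauM _ _).
  by rewrite /= in_itv/= s0.
(* The midpoint between the spectral radius, cut off at 0, and 1: thus [0 < r < 1] and [ln r] is
   negative. *)
pose r := (Num.max (spectral_radius A) 0 + 1) / 2.
have rho_max : spectral_radius A <= Num.max (spectral_radius A) 0.
  by rewrite le_max lexx.
have max0 : 0 <= Num.max (spectral_radius A) 0 by rewrite le_max lexx orbT.
have max1 : Num.max (spectral_radius A) 0 < 1 by rewrite gt_max rhoA ltr01.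
have rho_r : spectral_radius A < r by rewrite /r; lra.
have r0 : 0 < r by rewrite /r; lra.
have r1 : r < 1 by rewrite /r; lra.
have [K K0 AK] := norm_power_bound rho_r r0.
have lnr0 : ln r < 0 by rewrite ln_lt0// r0.
(* These come from [r ^+ n <= r^(t / M - 1)]. Taking [K + 1] makes [C] positive and covers the times
   at which no iteration takes place. *)
exists ((K + 1) / r), (- ln r / M); split.
- by rewrite divr_gt0//; lra.
- by rewrite divr_gt0//; lra.
move=> x [x_sol _] [_ x0_fin] t t0.
set N0 := Linfty_norm _ (history x 0).
have N0_fin := Linfty_norm_fin_num x0_fin.
set a := fine N0.
have N0E : N0 = a%:E by rewrite fineK.
have a0 : 0 <= a by rewrite fine_ge0// Lnorm_ge0.
pose E := expR (ln r * (t / M - 1)).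
have -> : (K + 1) / r * expR (- (- ln r / M) * t) = (K + 1) * E.
  rewrite -[in X in X * _](lnK r0) -mulrA -expRN -expRD /E; congr (_ * expR _).
  by ring.
rewrite N0E -EFinM; apply: Linfty_norm_le => [|muT].
  by rewrite lee_fin mulr_ge0// mulr_ge0 ?expR_ge0//; lra.
have aeF := ae_filter_ringOfSetsType (@completed_lebesgue_measure R).
pose I0 := lcitv (- largest_delay tau 0) 0.
pose P (s : R) := (0 <= s -> x s = A *m x (s - tau s)) /\
  (s < 0 -> I0 s -> `|x s| <= a).
have aeP : \forall s \ae @completed_lebesgue_measure R, P s.
  (* Among all the modifications allowed by [ae_solution], [x] itself is taken. *)
  apply: filterS2 (x_sol x _) (ae_le_Linfty_norm I0 (history x 0) muT).
    move=> s eq_s le_s; split=> // _ /le_s.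
    by rewrite -/N0 N0E lee_fin /history add0r.
  exact: aeW.
have /(ae_shift t) := ae_holds_along tau_null aeP.
apply: filterS => s along /lcitv_largest_delayP[inf_s s0].
rewrite lee_fin /history.
(* The history window reaches back by at most [M]; this is the loss of 1 in the exponent of [E]. *)
have ts_ge : t - M <= t + s.
  rewrite -lee_fin; apply: le_trans inf_s.
  apply: le_ereal_inf_tmp => _ [u /= tu <-].
  move: tu; rewrite in_itv/= andbT lee_fin => tu.
  by have := tauM u (le_trans t0 tu); lra.
(* If [t + s < 0], the point lies in the initial interval and [t < M], so [1 <= E] and the bound [a]
   suffices. *)
have [ts0|ts0] := leP 0 (t + s); last first.
  have [_ /(_ ts0) xa] := (along 0%N).1.
  have {}xa : `|x (t + s)| <= a.
    apply: xa; apply/lcitv_largest_delayP; split=> //; rewrite add0r.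
    apply: le_trans inf_s; apply: ereal_inf_le_tmp => _ [u /= tu <-].
    exists u => //.
    by move: tu; rewrite !in_itv/= !andbT; exact: le_trans.
  apply: le_trans xa _; rewrite -[leLHS]mul1r ler_wpM2r//.
  have : 1 <= E.
    rewrite -[leLHS]expR0 ler_expR mulr_le0 ?(ltW lnr0)//.
    by rewrite subr_le0 ler_pdivrMr//; lra.
  by nra.
(* This bound depends on [t + s], but it only makes the orbit terminate and does not enter [C] or
   [gamma]. *)
pose e := inf [set tau u | u in `[0, t + s]%classic].
have e0 : 0 < e by exact: tau_inf.
have etau u : 0 <= u <= t + s -> e <= tau u.
  move=> uts; apply: ge_inf; last by exists u => //=; rewrite in_itv.
  exists 0 => _ [v /= + <-]; rewrite in_itv/= => /andP[v0 _].
  exact: ltW (tau_delay v v0).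
have [k tsk] : exists k, t + s < e *+ k.
  have /archi_boundP := divr_ge0 ts0 (ltW e0).
  by rewrite ltr_pdivrMr// mulr_natl => ?; eexists; eassumption.
have [|||n [v [tsn va ->]]] :=
  @iterated_delay_equation _ _ A tau x M e (t + s) P (fun v => `|v| <= a)
    (t + s) k
    M0 tauM (ltW e0) etau _ _ _ tsk (along k).
- by move=> u [].
- move=> u u0 [_ xa] u1; apply: xa => //; apply/lcitv_largest_delayP.
  split => //; rewrite add0r; apply: ereal_inf_lbound; exists u => //=.
  by rewrite in_itv/= u0.
- by rewrite ts0 lexx.
apply: le_trans (AK n v) _; apply: ler_pM => //.
  by rewrite mulr_ge0// exprn_ge0// ltW.
apply: ler_pM; rewrite ?exprn_ge0 ?(ltW r0)//; first by lra.
(* Since [ln r < 0], it remains to see [t / M - 1 <= n], which follows from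
   [t - M <= t + s <= M *+ n]. *)
rewrite -[in leLHS](lnK r0) -expRM_natr ler_expR ler_nM2l// lerBlDr.
by rewrite ler_pdivrMr// mulrDl mulrC mulr_natr mul1r; lra.
Qed.
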